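(* Let $\mathbf u\in\mathcal A$, let $\mathcal I$ be a translation invariant free $P$-ideal of $\mathbb N$, and let $x\in[0,1)$ with $S=\operatorname{supp}(x)$ and $S_b=\operatorname{supp}_b(x)$. (1) If $S$ is $b$-bounded and $\bar x\in t_{\mathbf u}^{\mathcal I}(\mathbb T)$, then $S+1\subseteq^{\mathcal I}S$ and $S_b\subseteq_{\mathcal I}S$. (2) If $S+1\subseteq^{\mathcal I}S$ and $S_b\subseteq_{\mathcal I}S$, and $\mathcal I$ is nested, then $\bar x\in t_{\mathbf u}^{\mathcal I}(\mathbb T)$.
   Context: $\mathbb N=\{0,1,2,\dots\}$, $\mathbb N_+=\mathbb N\setminus\{0\}$, $\mathbb T=\mathbb R/\mathbb Z$ is the circle group, and $\bar x$ is the image of $x\in\mathbb R$ in $\mathbb T$. $\mathcal A$ is the family of arithmetic sequences: strictly increasing sequences of integers $\mathbf u=(u_n)_{n\in\mathbb N}$ with $u_0=1$ and $u_n\mid u_{n+1}$ for all $n$. Put $b_n=u_n/u_{n-1}$ for $n\in\mathbb N_+$. Every $x\in[0,1)$ has a unique representation $x=\sum_{n=1}^\infty c_n/u_n$ with $c_n\in\mathbb N$, $c_n<b_n$ for all $n\in\mathbb N_+$, and $c_n<b_n-1$ for infinitely many $n$; $\operatorname{supp}(x)=\{n\in\mathbb N_+:c_n\ne0\}$, $\operatorname{supp}_b(x)=\{n\in\mathbb N_+:c_n=b_n-1\}$. For $A\subseteq\mathbb N$ and $k\in\mathbb Z$, $A+k$ denotes $\{a+k:a\in A\}\cap\mathbb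 N$. An infinite $A\subseteq\mathbb N$ is $b$-bounded if $(b_n)_{n\in A}$ is bounded (the index $0$ being disregarded); finite sets are also regarded as $b$-bounded. An ideal $\mathcal I$ of $\mathbb N$ is a non-empty family of subsets of $\mathbb N$ closed under finite unions and subsets (not required to be proper); it is free if it contains all finite sets; it is a $P$-ideal if for every countable family $\{A_n\}\subseteq\mathcal I$ there is $A\in\mathcal I$ with $A_n\setminus A$ finite for all $n$; it is translation invariant if $A\in\mathcal I$ implies $A+k\in\mathcal I$ for all $k\in\mathbb Z$. Write $A\subseteq^{\mathcal I}B$ if $A\setminus B\in\mathcal I$, and $A\subseteq_{\mathcal I}B$ if $A\subseteq B$ and $B\setminus A\in\mathcal I$. A pair $((l_n)_{n\in\mathbb N},(r_n)_{n\in\mathbb N})$ of strictly increasing sequences in $\mathbb N$ is left nested if $l_n\le r_n<l_{n+1}-1$ for every $n\in\mathbb N$. A free ideal $\mathcal I$ of $\mathbb N$ is nested if for every left nested pair $((l_n),(r_n))$, $\{r_n:n\in\mathbb N\}\in\mathcal I$ implies $\{l_n:n\in\mathbb N\}\in\mathcal I$. $t_{\mathbf u}^{\mathcal I}(\mathbb T)$ is the set of $z\in\mathbb T$ such that $\{n\in\mathbb N:u_nz\notin U\}\in\mathcal I$ for every neighborhood $U$ of $0$ in $\mathbb T$. *)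

(* Defs.v *)
From HB Require Import structures.
From mathcomp Require Import all_boot all_order all_algebra.
From mathcomp Require Import generic_quotient ring_quotient.
From mathcomp Require Import all_classical all_reals all_analysis.

Set Implicit Arguments.
Unset Strict Implicit.
Unset Printing Implicit Defensive.

Import Order.TTheory GRing.Theory Num.Theory.
Import numFieldNormedType.Exports.

Local Open Scope classical_set_scope.
Local Open Scope ring_scope.
Local Open Scope quotient_scope.

(* The group R/Z; [Num.int_num_subdef] is the subgroup of integers of R. *)
Definition circle (R : realType) : Type :=
  Quotient.quot (GRing.ZmodClosed.clone R Num.int_num_subdef _).

Section CircleStructures.
Variable R : realType.

HB.instance Definition _ := GRing.Zmodule.on (circle R).
HB.instance Definition _ := Quotient.on (circle R).

(* Same open sets as [quotient_topology], which does not keep the group law. *)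
Definition circle_open (U : set (circle R)) : Prop :=
  open (\pi_(circle R) @^-1` U : set R).

Fact circle_openT : circle_open setT.
Proof. by rewrite /circle_open preimage_setT; exact: openT. Qed.

Fact circle_openI (A B : set (circle R)) :
  circle_open A -> circle_open B -> circle_open (A `&` B).
Proof. exact: openI. Qed.

Fact circle_open_bigU (J : Type) (f : J -> set (circle R)) :
  (forall i, circle_open (f i)) -> circle_open (\bigcup_i f i).
Proof. by move=> fo; apply: bigcup_open => i _; exact: fo. Qed.

HB.instance Definition _ :=
  isOpenTopological.Build (circle R) circle_openT circle_openI circle_open_bigU.

End CircleStructures.

Definition to_circle (R : realType) (x : R) : circle R := \pi_(circle R) x.

Definition arithmetic_seq (u : nat -> int) : Prop :=
  [/\ increasing_seq u, u 0%N = 1 & forall n, (u n %| u n.+1)%Z].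

(* Only the values at positive indices are meaningful. *)
Definition ratio_seq (u : nat -> int) (n : nat) : int := (u n %/ u n.-1)%Z.

(* The value [c 0] plays no role. *)
Definition representation (R : realType) (u : nat -> int) (x : R)
    (c : nat -> nat) : Prop :=
  [/\ series (fun n => (c n.+1)%:R / (u n.+1)%:~R : R) @ \oo --> x,
      forall n, (0 < n)%N -> (c n)%:Z < ratio_seq u n
    & infinite_set [set n | (0 < n)%N /\ (c n)%:Z < ratio_seq u n - 1]].

Definition digits (R : realType) (u : nat -> int) (x : R) : nat -> nat :=
  xget (fun=> 0%N) [set c | representation u x c].

Definition supp (R : realType) (u : nat -> int) (x : R) : set nat :=
  [set n | (0 < n)%N /\ digits u x n <> 0%N].

Definition suppb (R : realType) (u : nat -> int) (x : R) : set nat :=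
  [set n | (0 < n)%N /\ (digits u x n)%:Z = ratio_seq u n - 1].

Definition translate (A : set nat) (k : int) : set nat :=
  [set m | exists2 a, A a & a%:Z + k = m%:Z].

Definition b_bounded (u : nat -> int) (A : set nat) : Prop :=
  finite_set A \/
  exists M : int, forall n, A n -> (0 < n)%N -> ratio_seq u n <= M.

(* Properness is not required. *)
Record is_ideal (I : set (set nat)) : Prop := IsIdeal {
  ideal_nonempty : I !=set0;
  ideal_setU : forall A B, I A -> I B -> I (A `|` B);
  ideal_sub : forall A B, A `<=` B -> I B -> I A }.

Definition free_ideal (I : set (set nat)) : Prop :=
  is_ideal I /\ forall A, finite_set A -> I A.

Definition P_ideal (I : set (set nat)) : Prop :=
  is_ideal I /\
  forall F : nat -> set nat, (forall n, I (F n)) ->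
    exists2 A, I A & forall n, finite_set (F n `\` A).

Definition translation_invariant (I : set (set nat)) : Prop :=
  forall A, I A -> forall k : int, I (translate A k).

Definition subset_mod (I : set (set nat)) (A B : set nat) : Prop :=
  I (A `\` B).

Definition subset_comod (I : set (set nat)) (A B : set nat) : Prop :=
  A `<=` B /\ I (B `\` A).

Definition left_nested (l r : nat -> nat) : Prop :=
  [/\ increasing_seq l, increasing_seq r
    & forall n, (l n <= r n)%N /\ (r n < l n.+1 - 1)%N].

Definition nested_ideal (I : set (set nat)) : Prop :=
  free_ideal I /\
  forall l r : nat -> nat, left_nested l r -> I (range r) -> I (range l).

Definition t_set (R : realType) (u : nat -> int) (I : set (set nat)) :
    set (circle R) :=
  [set z | forall U : set (circle R), nbhs (0 : circle R) U ->
     I [set n | ~ U (z *~ u n)]].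

(* Main.v *)
(* The remainders [f n := u_n (x - sum_(k <= n) c_k / u_k)] lie in [0, 1], represent
   [u_n x] in the circle and satisfy [b_(n+1) f n = c_(n+1) + f (n+1)]; hence [x] is
   in [t_u^I] iff the set of [n] with [e <= f n <= 1 - e] is in [I] for all [e > 0].
   In (1), a digit [c_(n+1)] other than [0] and [b_(n+1) - 1], or a nonzero [c_(n+1)]
   followed by a zero, keeps [f n] away from [0] and [1], by a margin depending only
   on the bound of [b]. In (2), if [k] consecutive digits after [n] are all zero or
   all maximal, then [f n] is [2^-k]-close to [0] or [1]; otherwise the window meets
   [S \ Sb], [(S+1) \ S] or [S \ (S+1)]. The first two are in [I] by hypothesis and
   the third one because [I] is nested. *)
Require Import Defs.
From mathcomp Require Import all_boot all_order all_algebra.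
From mathcomp Require Import all_classical all_reals all_analysis.
From mathcomp Require Import generic_quotient ring_quotient.
From mathcomp Require Import zify lra ring.

Set Implicit Arguments.
Unset Strict Implicit.
Unset Printing Implicit Defensive.

Import Order.TTheory GRing.Theory Num.Theory.
Import numFieldNormedType.Exports.
Local Open Scope classical_set_scope.
Local Open Scope ring_scope.

(** * Minima and enumerations of sets of naturals *)

Lemma nat_least (A : set nat) : A !=set0 ->
  exists2 m, A m & forall k, A k -> (m <= k)%N.
Proof.
case=> a Aa; have [|m /asboolP Am mA] := @ex_minnP (fun k => `[< A k >]).
  by exists a; apply/asboolP.
by exists m => // k Ak; apply: mA; apply/asboolP.
Qed.

Lemma finite_set_bound (A : set nat) (g : nat -> nat) : finite_set A ->
  exists M, forall a, A a -> (g a <= M)%N.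
Proof.
move=> /finite_seqP[s ->]; exists (\max_(a <- s) g a) => a /= sa.
exact: leq_bigmax_seq.
Qed.

Lemma infinite_set_enum (A : set nat) : infinite_set A ->
  exists2 f : nat -> nat, increasing_seq f & range f = A.
Proof.
move=> Aoo; have /infinite_setN0/nat_least[a0 Aa0 a0A] := Aoo.
pose P x y := [/\ A y, (x < y)%N & forall z, A z -> (x < z)%N -> (y <= z)%N].
(* [f] starts at the least element of [A] and always moves to the next larger one. *)
have [x|f [f0 fS]] := @dependent_choice nat P _ a0.
  apply: cid; have [|y [Ay xy] yA] := @nat_least (A `&` [set y | (x < y)%N]).
    apply: infinite_setN0; apply: infinite_setIl => //.
    by apply: sub_finite_set (finite_II x.+1) => y /= /negP; rewrite -leqNgt ltnS.
  by exists y; split=> // z Az xz; apply: yA.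
have fltn n : (f n < f n.+1)%N by have [] := fS n.
exists f; first by apply/increasing_seqP.
apply/seteqP; split=> [_ [n _ <-]|a Aa].
  by case: n => [|n]; [rewrite f0|have [] := fS n].
have nf n : (n <= f n)%N by elim: n => // n; have := fltn n; lia.
have [|n /= an nmin] := @nat_least [set n | (a <= f n)%N]; first by exists a => /=.
case: n an nmin => [|n] an nmin.
  by exists 0%N => //; have := a0A _ Aa; move: an; rewrite f0; lia.
have fna : (f n < a)%N.
  by rewrite ltnNge; apply/negP => /nmin; rewrite ltnn.
by exists n.+1 => //; have [_ _ /(_ _ Aa fna)] := fS n; lia.
Qed.

Lemma translate1E (A : set nat) (n : nat) : translate A 1 n.+1 <-> A n.
Proof.
by split=> [[a Aa an]|An]; [have <- : a = n by lia|exists n => //; lia].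
Qed.

(** * Translation invariant and nested ideals *)

Section IdealLemmas.
Variable I : set (set nat).
Hypotheses (hI : is_ideal I) (htr : translation_invariant I).

Lemma ideal_preimage_addn (A : set nat) (k : nat) :
  I A -> I [set n | A (n + k)%N].
Proof.
move=> /htr/(_ (- k%:Z)); apply: ideal_sub hI _ _ _ => n An.
by exists (n + k)%N => //; lia.
Qed.

Lemma ideal_bigcup (F : nat -> set nat) (k : nat) :
  I set0 -> (forall n, I (F n)) -> I [set n | exists2 j, (j < k)%N & F j n].
Proof.
move=> I0 IF; elim: k => [|k IHk]; first by apply: ideal_sub hI _ _ _ I0 => n [].
apply: ideal_sub hI _ _ _ (ideal_setU hI IHk (IF k)) => n [j].
by rewrite ltnS leq_eqVlt => /orP[/eqP->|jk] Fjn; [right|left; exists j].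
Qed.

(* The left and right ends of the maximal intervals of [S] form a left nested pair,
   and the right ends are the points of [(S+1) \ S], shifted by [-1]. *)
Lemma nested_left_ends (S : set nat) : nested_ideal I ->
  I (translate S 1 `\` S) -> I (S `\` translate S 1).
Proof.
move=> [[_ Ifin] Inest] Iexit.
have [Lfin|Loo] := pselect (finite_set (S `\` translate S 1)); first exact: Ifin.
have [l lincr lL] := infinite_set_enum Loo.
have lrange := lL; have {}lL n : (S `\` translate S 1) (l n) by rewrite -lL; exists n.
have llt n : (l n < l n.+1)%N by move/increasing_seqP : (lincr); exact.
(* The point before [l n.+1] is outside [S], so it differs from [l n]; this yields the gap required
   of a left nested pair. *)
have lgap n : exists m, [/\ (l n <= m)%N, ~ S m.+1 & l n.+1 = m.+2].
  have [Sl _] := lL n; have [Sl' nSl'] := lL n.+1; have := llt n.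
  case: (l n.+1) Sl' nSl' => [//|p] _ /translate1E nSp.
  rewrite ltnS leq_eqVlt => /orP[/eqP lp|]; first by case: nSp; rewrite -lp.
  by case: p nSp => // m nSm lm; exists m.
(* [r n] is the first point from [l n] on whose successor leaves [S]. *)
have /choice[r rP] : forall n, exists r,
    [/\ (l n <= r)%N, (r < l n.+1 - 1)%N, S r & ~ S r.+1].
  move=> n; have [m [lm Sm ->]] := lgap n.
  have [|r [lr Sr] rmin] := @nat_least [set r | (l n <= r)%N /\ ~ S r.+1].
    by exists m.
  have rm : (r <= m)%N by apply: rmin.
  exists r; split=> //.
  have [Sl _] := lL n.
  move: lr; rewrite leq_eqVlt => /orP[/eqP <- //|lr].
  apply: contrapT => nSr; have := rmin r.-1.
  by case: r lr {Sr rm rmin} nSr => [|r] //= lr nSr /(_ (conj lr nSr)); rewrite ltnn.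
have Irange : I (range r).
  apply: ideal_sub hI _ _ _ (ideal_preimage_addn 1 Iexit) => _ [n _ <-] /=.
  by have [_ _ Sr Sr1] := rP n; rewrite addn1; split => //; apply/translate1E.
rewrite -lrange; apply: Inest Irange; split=> //.
  apply/increasing_seqP => n.
  by have [_ rl _ _] := rP n; have [lr _ _ _] := rP n.+1; lia.
by move=> n; have [] := rP n.
Qed.
End IdealLemmas.

(** * Neighborhoods of zero in the circle *)

Section Circle.
Variable R : realType.

Lemma to_circle_eqP (x y : R) :
  to_circle x = to_circle y <-> exists k : int, x = y + k%:~R.
Proof.
have eqE : (to_circle x == to_circle y) = (x - y \is a Num.int).
  by rewrite /to_circle -Quotient.idealrBE.
split=> [/eqP|[k xy]].
  by rewrite eqE => /intrP[k xy]; exists k; rewrite -xy subrKC.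
by apply/eqP; rewrite eqE xy addrC addKr intr_int.
Qed.

Lemma to_circleMz (x : R) (k : int) : to_circle x *~ k = to_circle (x * k%:~R).
Proof. by rewrite /to_circle mulrzr -raddfMz. Qed.

(** The preimage of this image in [R] is the union of the balls of radius [e] around the
    integers. *)
Lemma nbhs_circle0 (e : R) : 0 < e ->
  nbhs (0 : circle R) (@to_circle R @` [set y | `|y| < e]).
Proof.
move=> e0; apply: open_nbhs_nbhs; split; last first.
  by exists 0; rewrite /= ?normr0// /to_circle raddf0.
suff : circle_open (@to_circle R @` [set y | `|y| < e]) by [].
rewrite /circle_open (_ : _ @^-1` _ = \bigcup_(k : int) ball (k%:~R : R) e).
  by apply: bigcup_open => k _; exact: ball_open.
apply/seteqP; split=> y /=.
  move=> [z ze /esym/to_circle_eqP[k ->]]; exists k => //=.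
  by rewrite -ball_normE /= opprD addrCA subrr addr0 normrN.
move=> [k _]; rewrite -ball_normE /= => ke.
exists (y - k%:~R); first by rewrite /= distrC.
by apply/to_circle_eqP; exists (- k); rewrite mulrNz.
Qed.

Lemma nbhs_circle0_ball (U : set (circle R)) : nbhs (0 : circle R) U ->
  exists2 e : R, 0 < e & forall y, `|y| < e -> U (to_circle y).
Proof.
rewrite nbhsE => -[V [Vo V0] VU].
have : nbhs (0 : R) (@to_circle R @^-1` V).
  by apply: open_nbhs_nbhs; split=> //; rewrite /to_circle /= raddf0.
case/nbhs_ballP => e /= e0 eV; exists e => // y ye.
by apply: VU; apply: eV; rewrite -ball_normE /= sub0r normrN.
Qed.

(** A point of [[0, 1]] is close to zero in the circle exactly when it is close to 0 or to 1. *)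
Lemma t_setP (u : nat -> int) (I : set (set nat)) (x : R) (f : nat -> R) :
  is_ideal I -> (forall n, 0 <= f n <= 1) ->
  (forall n, exists k : int, x * (u n)%:~R = f n + k%:~R) ->
  t_set u I (to_circle x) <->
  forall e, 0 < e -> I [set n | e <= f n <= 1 - e].
Proof.
move=> hI f01 fx; split=> [tx e e0|tx U /nbhs_circle0_ball[e e0 eU]].
  apply: ideal_sub hI _ _ _ (tx _ (nbhs_circle0 e0)) => n /= fe [y ye].
  rewrite to_circleMz => /to_circle_eqP[k]; have [j ->] := fx n => yf.
  have {}yf : y = f n + (j + k)%:~R by rewrite yf intrD addrA.
  (* Adding a nonnegative integer to [f n] gives [y >= e], adding a negative one gives
     [y <= - e]. *)
  have [i0|i0] : (j + k >= 0) \/ (j + k <= -1) by lia.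
    have : (0 : R) <= (j + k)%:~R by rewrite ler0z.
    by move: ye fe; rewrite yf ltr_norml; lra.
  have : (j + k)%:~R <= (-1 : R) by rewrite -(@ler_int R) in i0.
  by move: ye fe; rewrite yf ltr_norml; lra.
apply: ideal_sub hI _ _ _ (tx _ e0) => n /= nU.
have [k xk] := fx n.
apply/andP; split; rewrite leNgt; apply/negP => fe; apply: nU; rewrite to_circleMz.
  have -> : to_circle (x * (u n)%:~R) = to_circle (f n).
    by apply/to_circle_eqP; exists k.
  by apply: eU; have := f01 n; rewrite ltr_norml; lra.
have -> : to_circle (x * (u n)%:~R) = to_circle (f n - 1).
  by apply/to_circle_eqP; exists (k + 1); rewrite xk intrD; ring.
by apply: eU; have := f01 n; rewrite ltr_norml; lra.
Qed.

End Circle.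

(** * Digits against remainders *)

Section DigitExpansion.
Variables (R : realType) (b : nat -> int) (c : nat -> nat) (f : nat -> R).
Hypotheses (b_ge2 : forall n, 2 <= b n.+1).
Hypotheses (c_lt : forall n, (c n.+1)%:Z < b n.+1).
Hypotheses (f01 : forall n, 0 <= f n <= 1).
Hypotheses (fS : forall n, (b n.+1)%:~R * f n = (c n.+1)%:R + f n.+1).

Let bR2 n : (2 : R) <= (b n.+1)%:~R.
Proof. by rewrite (_ : 2 = 2%:~R)// ler_int. Qed.

(** After a zero digit [f n.+1 = b n.+1 * f n], so each step at least doubles a quantity that never
    exceeds 1. *)
Lemma remainder_zeros k n :
  (forall j, (j < k)%N -> c (n + j).+1 = 0%N) -> 2 ^+ k * f n <= 1.
Proof.
elim: k n => [|k IHk] n c0; first by rewrite expr0 mul1r; case/andP: (f01 n).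
have : 2 ^+ k * f n.+1 <= 1.
  by apply: IHk => j jk; rewrite addSnnS; apply: c0.
have := fS n; have := c0 0%N isT; rewrite addn0 => -> /=; rewrite add0r => <-.
apply: le_trans; rewrite exprSr -mulrA ler_wpM2l ?exprn_ge0//.
by rewrite ler_wpM2r//; case/andP: (f01 n).
Qed.

(** The same doubling acts on [1 - f n], as a maximal digit gives
    [1 - f n.+1 = b n.+1 * (1 - f n)]. *)
Lemma remainder_tops k n :
  (forall j, (j < k)%N -> (c (n + j).+1)%:Z = b (n + j).+1 - 1) ->
  2 ^+ k * (1 - f n) <= 1.
Proof.
elim: k n => [|k IHk] n cb; first by rewrite expr0 mul1r; have := f01 n; lra.
have : 2 ^+ k * (1 - f n.+1) <= 1.
  by apply: IHk => j jk; rewrite addSnnS; apply: cb.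
have {}cb : (c n.+1)%:R = (b n.+1)%:~R - 1 :> R.
  have := cb 0%N isT.
  by rewrite addn0 => /(congr1 (fun i : int => i%:~R : R)); rewrite intrB.
have -> : 1 - f n.+1 = (b n.+1)%:~R * (1 - f n).
  by have := fS n; rewrite cb mulrBr mulr1 => ->; ring.
apply: le_trans; rewrite exprSr -mulrA ler_wpM2l ?exprn_ge0//.
by rewrite ler_wpM2r//; have := f01 n; lra.
Qed.

(** For [b := ratio_seq u] and [c := digits u x], this set and the next unfold to [supp u x] and
    [suppb u x]. *)
Definition nonzero_digits := [set n | (0 < n)%N /\ c n <> 0%N].
Definition top_digits := [set n | (0 < n)%N /\ (c n)%:Z = b n - 1].
Local Notation S := nonzero_digits.
Local Notation Sb := top_digits.

Lemma top_digits_sub : Sb `<=` S.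
Proof. by case=> [[]//|n] [_ cb]; split=> //; have := b_ge2 n; lia. Qed.

(** Here [1 <= c n.+1 <= b n.+1 - 2], so [b n.+1 * f n] lies between 1 and [b n.+1 - 1]. *)
Lemma remainder_middle_digit (M : int) n : b n.+1 <= M -> (S `\` Sb) n.+1 ->
  (M%:~R)^-1 <= f n <= 1 - (M%:~R)^-1.
Proof.
move=> bM [[_ c0] nSb].
have c1 : (1 : R) <= (c n.+1)%:R by rewrite ler1n; lia.
have c2 : (c n.+1)%:R + 1 <= (b n.+1)%:~R - 1 :> R.
  suff : (c n.+1)%:Z + 1 <= b n.+1 - 1 by rewrite -(@ler_int R) intrB intrD.
  have := c_lt n; have : (c n.+1)%:Z <> b n.+1 - 1 by move=> cb; apply: nSb.
  by lia.
have M0 : (0 : R) < M%:~R by rewrite ltr0z; have := b_ge2 n; lia.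
have MbR : (b n.+1)%:~R <= M%:~R :> R by rewrite ler_int.
have := fS n; have := f01 n; have := f01 n.+1; have := bR2 n.
move: (f n) (f n.+1) (c n.+1)%:R c1 c2 MbR => y z C c1 c2 bMR b2 z01 y01 fSn.
apply/andP; split.
  by rewrite -div1r ler_pdivrMr//; nra.
by rewrite lerBrDl -lerBrDr -div1r ler_pdivrMr//; nra.
Qed.

(** The factor 2 comes from the zero digit, which forces [f n.+1 <= 1/2]; hence [b n.+1 * f n] lies
    between 1 and [b n.+1 - 1/2]. *)
Lemma remainder_exit (M : int) n : b n.+1 <= M -> S n.+1 -> ~ S n.+2 ->
  (2 * M%:~R)^-1 <= f n <= 1 - (2 * M%:~R)^-1.
Proof.
move=> bM [_ c0] nS.
have c20 : c n.+2 = 0%N by apply: contrapT => c2; apply: nS.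
have c1 : (1 : R) <= (c n.+1)%:R by rewrite ler1n; lia.
have c2 : (c n.+1)%:R <= (b n.+1)%:~R - 1 :> R.
  suff : (c n.+1)%:Z <= b n.+1 - 1 by rewrite -(@ler_int R) intrB.
  by have := c_lt n; lia.
have M0 : (0 : R) < M%:~R by rewrite ltr0z; have := b_ge2 n; lia.
have MbR : (b n.+1)%:~R <= M%:~R :> R by rewrite ler_int.
have z12 : f n.+1 <= 2^-1.
  have := fS n.+1; have := bR2 n.+1; have := f01 n.+1; have := f01 n.+2.
  by rewrite c20 add0r; nra.
have := fS n; have := f01 n; have := f01 n.+1; have := bR2 n.
move: (f n) (f n.+1) (c n.+1)%:R z12 c1 c2 MbR => y z C z12 c1 c2 bMR b2 z01 y01 fSn.
apply/andP; split.
  by rewrite -div1r ler_pdivrMr; nra.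
by rewrite lerBrDl -lerBrDr -div1r ler_pdivrMr; nra.
Qed.

(** A constant run extends by one digit unless that digit is neither zero nor maximal, or switches
    type: from zero to maximal enters [S], from maximal to zero leaves it. *)
Lemma digit_window n k :
  [\/ forall j, (j < k)%N -> c (n + j).+1 = 0%N,
      forall j, (j < k)%N -> (c (n + j).+1)%:Z = b (n + j).+1 - 1
    | exists2 j, (j < k)%N &
      ((S `\` Sb) `|` (S `\` translate S 1) `|` (translate S 1 `\` S)) (n + j).+1].
Proof.
elim: k => [|k [zeros|tops|[j jk Dj]]]; [by apply: Or31| | |]; last first.
- by apply: Or33; exists j => //; apply: ltnW.
- have [Sk|nSk] := pselect (S (n + k).+1).
    have [Sbk|nSbk] := pselect (Sb (n + k).+1); last first.
      by apply: Or33; exists k => //; do 2 left.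
    apply: Or32 => j; rewrite ltnS leq_eqVlt => /orP[/eqP->|/tops//].
    by case: Sbk.
  (* For [k = 0] there is no previous digit, and the new zero alone is a run of zeros. *)
  case: k tops nSk => [|k] tops nSk.
    apply: Or31 => -[|//] _; apply: contrapT => c0; exact: nSk.
  apply: Or33; exists k.+1 => //; right; split=> //.
  rewrite addnS; apply/translate1E; apply: top_digits_sub; split=> //.
  exact: tops.
- have [Sk|nSk] := pselect (S (n + k).+1); last first.
    apply: Or31 => j; rewrite ltnS leq_eqVlt => /orP[/eqP->|/zeros//].
    by apply: contrapT => c0; apply: nSk.
  have [Sbk|nSbk] := pselect (Sb (n + k).+1); last first.
    by apply: Or33; exists k => //; do 2 left.
  case: k zeros Sk Sbk => [|k] zeros Sk Sbk.
    by apply: Or32 => -[|//] _; case: Sbk.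
  apply: Or33; exists k.+1 => //; left; right; split=> //.
  rewrite addnS => /translate1E[_].
  by rewrite zeros.
Qed.

(** * Remainders modulo the ideal *)

Section WithIdeal.
Variable I : set (set nat).
Hypotheses (hfree : free_ideal I) (htr : translation_invariant I).
Let hI : is_ideal I := hfree.1.

Lemma remainders_small_necessary (M : int) :
  (forall n, S n -> b n <= M) ->
  (forall e : R, 0 < e -> I [set n | e <= f n <= 1 - e]) ->
  I (translate S 1 `\` S) /\ I (S `\` Sb).
Proof.
move=> SM If.
(* As the ratios are at least 2, a bound below 2 leaves [S] empty. *)
have [M0|M0] := ltP M 2.
  have S0 n : ~ S n.
    by case: n => [[]//|n] /SM; have := b_ge2 n; lia.
  split; apply: ideal_sub hI _ _ _ (hfree.2 _ (@finite_set0 nat)) => n [].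
    by case=> a /S0.
  by move=> /S0.
have MR0 : (0 : R) < M%:~R by rewrite ltr0z; lia.
split; [have e0 : (0 : R) < (2 * M%:~R)^-1|have e0 : (0 : R) < M%:~R^-1].
- by rewrite invr_gt0 mulr_gt0.
(* An exit at [m] constrains [f] at [m - 2], hence the shift by 2; a middle digit at [m] constrains
   [f] at [m - 1]. *)
- apply: ideal_sub hI _ _ _ (htr (If _ e0) 2) => m [[a Sa am] nSm].
  case: a Sa am => [[]//|a] Sa am; exists a; last by lia.
  apply: remainder_exit => //; first exact: SM.
  by have -> : a.+2 = m by lia.
- by rewrite invr_gt0.
- apply: ideal_sub hI _ _ _ (htr (If _ e0) 1) => -[[[]//]|n] nS.
  by exists n; [apply: remainder_middle_digit => //; apply: SM; case: nS|lia].
Qed.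

Lemma remainders_small_sufficient : nested_ideal I ->
  I (translate S 1 `\` S) -> I (S `\` Sb) ->
  forall e : R, 0 < e -> I [set n | e <= f n <= 1 - e].
Proof.
move=> hnest Iexit Imid e e0.
have Ientry := nested_left_ends hI htr hnest Iexit.
(* Window length: [k] constant digits put the remainder within [2 ^- k < e] of 0 or 1. *)
have [k ke] : exists k : nat, 1 < 2 ^+ k * e.
  exists (Num.bound e^-1); rewrite -ltr_pdivrMr// div1r.
  have /archi_boundP/lt_trans : 0 <= e^-1 by rewrite invr_ge0 ltW.
  by apply; rewrite -natrX ltr_nat ltn_expl.
have ID : I ((S `\` Sb) `|` (S `\` translate S 1) `|` (translate S 1 `\` S)).
  by do 2 apply: ideal_setU => //.
have Iwin := ideal_bigcup hI k (hfree.2 _ (@finite_set0 nat))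
  (fun j => ideal_preimage_addn hI htr j.+1 ID).
apply: ideal_sub hI _ _ _ Iwin => n /= /andP[fe f1e].
have k0 : (0 : R) < 2 ^+ k by rewrite exprn_gt0.
case: (digit_window n k) => [/remainder_zeros fn|/remainder_tops fn|[j jk Dj]].
- by exfalso; move: fe; rewrite -(ler_pM2l k0); lra.
- have : e <= 1 - f n by lra.
  by rewrite -(ler_pM2l k0); lra.
- by exists j; rewrite // addnS.
Qed.

End WithIdeal.
End DigitExpansion.

(** * Existence of the representation and its remainders *)

Section Representation.
Variables (R : realType) (u : nat -> int).
Hypothesis hu : arithmetic_seq u.
Local Notation b := (ratio_seq u).

Lemma arithmetic_seq_gt0 n : 0 < u n.
Proof.
have [uincr u0 _] := hu.
by apply: lt_le_trans (_ : u 0%N <= u n); [rewrite u0|rewrite uincr].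
Qed.

Lemma arithmetic_seqS n : u n.+1 = b n.+1 * u n.
Proof. by have [_ _ udvd] := hu; rewrite /ratio_seq /= divzK. Qed.

Lemma ratio_seq_ge2 n : 2 <= b n.+1.
Proof.
have [/increasing_seqP/(_ n) uS _ _] := hu.
have := arithmetic_seq_gt0 n; move: uS; rewrite arithmetic_seqS; nia.
Qed.

Let uR0 n : (0 : R) < (u n)%:~R.
Proof. by rewrite ltr0z arithmetic_seq_gt0. Qed.

Let uRS n : (u n.+1)%:~R = (b n.+1)%:~R * (u n)%:~R :> R.
Proof. by rewrite -intrM -arithmetic_seqS. Qed.

Lemma arithmetic_seq_ge n : n%:Z < u n.
Proof.
elim: n => [|n]; first exact: arithmetic_seq_gt0.
by rewrite arithmetic_seqS; have := ratio_seq_ge2 n; nia.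
Qed.

Section Remainder.
Variables (x : R) (c : nat -> nat).

(** The terms have index below [n], so the digits involved are [c 1] to [c n]. *)
Definition partial_sum n : R :=
  series (fun n => (c n.+1)%:R / (u n.+1)%:~R : R) n.

Definition remainder n : R := (u n)%:~R * (x - partial_sum n).

Lemma partial_sumS n :
  partial_sum n.+1 = partial_sum n + (c n.+1)%:R / (u n.+1)%:~R.
Proof. by rewrite /partial_sum /series /= big_nat_recr. Qed.

Lemma remainderS n :
  (b n.+1)%:~R * remainder n = (c n.+1)%:R + remainder n.+1.
Proof.
rewrite /remainder mulrA -uRS partial_sumS; field.
by rewrite gt_eqF.
Qed.

(** [u n] clears every denominator of the partial sum, by divisibility. *)
Lemma remainder_int n : exists k : int, x * (u n)%:~R = remainder n + k%:~R.
Proof.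
suff [k kn] : exists k : int, (u n)%:~R * partial_sum n = k%:~R.
  by exists k; rewrite -kn /remainder; ring.
elim: n => [|n [k kn]].
  by exists 0; rewrite /partial_sum /series /= big_geq ?mulr0.
exists (b n.+1 * k + c n.+1); rewrite partial_sumS mulrDr mulrCA divff ?gt_eqF//.
by rewrite mulr1 uRS -mulrA kn intrD intrM.
Qed.

(** Partial sums increase to [x]; with [1 / u m] added they are nonincreasing, because
    [c m.+1 + 1 <= b m.+1]. So [x] is bracketed. *)
Lemma remainder_itv : representation u x c -> forall n, 0 <= remainder n <= 1.
Proof.
move=> [cx cb _] n.
have Pincr : nondecreasing_seq partial_sum.
  by apply/nondecreasing_seqP => m; rewrite partial_sumS lerDl divr_ge0// ltW.
have Qdecr : nonincreasing_seq (fun m => partial_sum m + ((u m)%:~R)^-1).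
  apply/nonincreasing_seqP => m; rewrite partial_sumS -addrA lerD2l.
  have cm : (c m.+1)%:R + 1 <= (b m.+1)%:~R :> R.
    by have := cb m.+1 isT; rewrite -lezD1 -(@ler_int R) intrD.
  rewrite -[X in _ + X]div1r -mulrDl ler_pdivrMr// uRS mulrCA mulVf ?mulr1//.
  by rewrite gt_eqF.
apply/andP; split.
  rewrite /remainder mulr_ge0 ?(ltW (uR0 n))// subr_ge0; apply: (cvgr_to_ge cx).
  by exists n => // m /= nm; apply: Pincr.
rewrite /remainder mulrC -ler_pdivlMr// div1r lerBlDl.
apply: (cvgr_to_le cx); exists n => // m /= nm.
by apply: le_trans (Qdecr _ _ nm); rewrite lerDl invr_ge0 ltW.
Qed.

End Remainder.

(** The digits come from the integer parts [d n] of [x * u n], which makes the fractional parts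
    [g n] the remainders. *)
Lemma representation_exists (x : R) : 0 <= x < 1 ->
  exists c, representation u x c.
Proof.
move=> /andP[x0 x1].
pose d n := Num.floor (x * (u n)%:~R); pose g n := x * (u n)%:~R - (d n)%:~R.
have g01 n : 0 <= g n < 1.
  by have := floor_itv (x * (u n)%:~R); rewrite -/(d n) /g intrD; lra.
have gS n : (b n.+1)%:~R * g n = (d n.+1 - b n.+1 * d n)%:~R + g n.+1.
  by rewrite /g intrB intrM uRS; ring.
have dS n : 0 <= d n.+1 - b n.+1 * d n < b n.+1.
  have bR : (2 : R) <= (b n.+1)%:~R.
    by rewrite (_ : 2 = 2%:~R)// ler_int ratio_seq_ge2.
  (* [b n.+1 * g n] is in [[0, b n.+1)] and [g n.+1] in [[0, 1)]; their difference is an integer. *)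
  have [h1 h2] : (-1 : R) < (d n.+1 - b n.+1 * d n)%:~R /\
      (d n.+1 - b n.+1 * d n)%:~R < (b n.+1)%:~R :> R.
    by have := gS n; have := g01 n; have := g01 n.+1; nra.
  by move: h1 h2; rewrite (_ : -1 = (-1)%:~R)// !ltr_int; lia.
pose c n := `|(d n - b n * d n.-1)%R|%N.
have cE n : (c n.+1)%:Z = d n.+1 - b n.+1 * d n.
  by rewrite /c /= gez0_abs//; case/andP: (dS n).
have cRE n : (c n.+1)%:R = (d n.+1 - b n.+1 * d n)%:~R :> R by rewrite -cE.
have d0 : d 0%N = 0.
  by apply/floor_def; have [_ -> _] := hu; rewrite mulr1 x0.
have gE n : remainder x c n = g n.
  suff P n' : (u n')%:~R * partial_sum c n' = (d n')%:~R.
    by rewrite /remainder /g mulrBr P mulrC.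
  elim: n' => [|m IHm]; first by rewrite d0 /partial_sum /series /= big_geq ?mulr0.
  rewrite partial_sumS mulrDr mulrCA divff ?gt_eqF// mulr1 uRS -mulrA IHm.
  by rewrite cRE intrB intrM; ring.
exists c; split.
- apply/cvgrPdist_le => e e0; exists (Num.bound e^-1) => // n /= en.
  rewrite -/(partial_sum c n).
  have -> : x - partial_sum c n = g n / (u n)%:~R.
    by rewrite -gE /remainder mulrC mulKf ?gt_eqF.
  have gn := g01 n.
  rewrite ger0_norm; last by rewrite divr_ge0 ?(ltW (uR0 n))//; lra.
  have ue : e^-1 < (u n)%:~R.
    have /archi_boundP/lt_trans : 0 <= e^-1 by rewrite invr_ge0 ltW.
    apply; rewrite -[_%:R]/((Posz _)%:~R) ltr_int.
    by have := arithmetic_seq_ge n; lia.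
  rewrite ler_pdivrMr//; apply: (@le_trans _ _ 1); first by lra.
  by rewrite mulrC -ler_pdivrMr// div1r ltW.
- by case=> // n _; rewrite cE; case/andP: (dS n).
(* Digits maximal from some [N] on would give [1 - g N <= 2 ^- k] for all [k], against [g N < 1]. *)
- move=> fin.
  have [N Ntop] : exists N, forall n, (N <= n)%N -> (c n.+1)%:Z = b n.+1 - 1.
    have [N NP] := finite_set_bound id fin.
    exists N => n Nn; apply: contrapT => ntop.
    have : (n.+1 <= N)%N by apply: NP; split=> //=; have := dS n; rewrite -cE; lia.
    by rewrite ltnNge Nn.
  have top k : 2 ^+ k * (1 - g N) <= 1.
    rewrite -gE; apply: (remainder_tops ratio_seq_ge2).
    + by move=> n; rewrite gE; have := g01 n; lra.
    + by move=> n; apply: remainderS.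
    + by move=> j _; apply: Ntop; rewrite leq_addr.
  have gN : 0 < 1 - g N by have := g01 N; lra.
  have := top (Num.bound (1 - g N)^-1); apply/negP; rewrite -ltNge.
  rewrite -ltr_pdivrMr// div1r.
  have /archi_boundP/lt_trans : 0 <= (1 - g N)^-1 by rewrite invr_ge0 ltW.
  by apply; rewrite -natrX ltr_nat ltn_expl.
Qed.
End Representation.

Theorem corollary5p8 (R : realType) (u : nat -> int) (I : set (set nat))
    (x : R) (hu : arithmetic_seq u)
    (hfree : free_ideal I) (hP : P_ideal I) (htr : translation_invariant I)
    (hx : 0 <= x < 1) :
  let S := supp u x in
  let Sb := suppb u x in
  (b_bounded u S -> t_set u I (to_circle x) ->
     subset_mod I (translate S 1) S /\ subset_comod I Sb S) /\
  (subset_mod I (translate S 1) S -> subset_comod I Sb S -> nested_ideal I ->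
     t_set u I (to_circle x)).
Proof.
move=> S Sb; have hI := hfree.1.
(* Existence ensures that [xget] returns a genuine representation and not its default. *)
have rep : representation u x (digits u x).
  by apply: (xgetPex (fun=> 0%N)); apply: representation_exists.
have b2 := ratio_seq_ge2 hu.
have c_lt n : (digits u x n.+1)%:Z < ratio_seq u n.+1 by have [_ ->] := rep.
have f01 := remainder_itv hu rep.
have fS := remainderS hu x (digits u x).
have tP := t_setP hI f01 (remainder_int hu x (digits u x)).
split=> [Sbounded /tP small|exit [_ mid] nest].
  have [M SM] : exists M : int, forall n, S n -> ratio_seq u n <= M.
    case: Sbounded => [Sfin|[M SM]]; last first.
      by exists M => n Sn; apply: SM => //; case: Sn.
    have [M SM] := finite_set_bound (fun n => `|ratio_seq u n|%N) Sfin.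
    by exists M => n /SM; lia.
  have [exit mid] := remainders_small_necessary b2 c_lt f01 fS hfree htr SM small.
  by do 2 split=> //; apply: top_digits_sub.
by apply/tP; apply: (remainders_small_sufficient b2 f01 fS).
Qed.
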